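(* Let $\mathbf{h}$ be a weakly increasing sequence of positive integers with $\mathbf{h}(i)>i$ for all $i$. Let $S$ be a nonempty $\mathbf{h}$-admissible set and $m=\mathbf{m}(S)$. Then, as polynomials in $n$ (equivalently, for all integers $n\ge\mathbf{j}(S)$), $$\mathcal{I}_\mathbf{h}(S;n)=\sum_{k=0}^{m} a_k(S)\binom{n-\mathbf{h}(m)+1}{k},$$ where, with $N=m+\mathbf{h}(m)-1$, $$a_k(S)=\#\{\pi\in I_\mathbf{h}(S,N):\ \{\pi_1,\dots,\pi_m\}\cap[\mathbf{h}(m),N]=[\mathbf{h}(m),\mathbf{h}(m)+k-1]\}$$ (for $k=0$ the interval on the right is empty).
   Context: $\mathcal{P}_\mathbf{h}=\{(i,j): i<j\le \mathbf{h}(i)\}$. For $\pi\in S_n$ (one-line notation $\pi_1\cdots\pi_n$), $\mathrm{inv}_\mathbf{h}(\pi)=\{(i,j)\in\mathcal{P}_\mathbf{h}: j\le n,\ \pi_i>\pi_j\}$. $S\subseteq\mathcal{P}_\mathbf{h}$ is $\mathbf{h}$-admissible if $S=\mathrm{inv}_\mathbf{h}(\pi)$ for some permutation $\pi$ of some $S_n$. $I_\mathbf{h}(S,n)=\{\pi\in S_n:\mathrm{inv}_\mathbf{h}(\pi)=S\}$, $\mathcal{I}_\mathbf{h}(S;n)=\#I_\mathbf{h}(S,n)$; $\mathbf{j}(S)=\max\{j:(i,j)\in S\}$, and $\mathcal{I}_\mathbf{h}(S;n)$ agrees with a polynomial in $n$ for $n\ge\mathbf{j}(S)$. $\mathbf{m}(S)=\max\{i:(i,i+1)\in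 S\}$. $[a,b]=\{a,a+1,\dots,b\}$. *)

(* Defs.v *)
From mathcomp Require Export all_boot all_order all_algebra all_fingroup finmap.

Set Implicit Arguments.
Unset Strict Implicit.
Unset Printing Implicit Defensive.

Export Order.TTheory GRing.Theory Num.Theory.

Local Open Scope fset_scope.

(* Positions and values are 1-based in the mathematics and 0-based in 'I_n:
   i : 'I_n stands for i.+1, so the one-line entry pi_(i.+1) is (pi i).+1.
   A sequence h(1), h(2), ... is a function nat -> nat; h 0 is never used. *)
Definition Ph (h : nat -> nat) : pred (nat * nat) :=
  [pred ij | [&& 0 < ij.1, ij.1 < ij.2 & ij.2 <= h ij.1]].

Definition invh (h : nat -> nat) (n : nat) (pi : 'S_n) : {fset nat * nat} :=
  [fset ((nat_of_ord ij.1).+1, (nat_of_ord ij.2).+1) | ij : 'I_n * 'I_n in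
     [pred ij : 'I_n * 'I_n |
        Ph h ((nat_of_ord ij.1).+1, (nat_of_ord ij.2).+1)
        && (pi ij.2 < pi ij.1)]].

Definition admissible (h : nat -> nat) (S : {fset nat * nat}) : Prop :=
  {subset S <= Ph h} /\ exists (n : nat) (pi : 'S_n), S = invh h pi.

Definition Ih (h : nat -> nat) (S : {fset nat * nat}) (n : nat) : {set 'S_n} :=
  [set pi : 'S_n | invh h pi == S].

Definition jmax (S : {fset nat * nat}) : nat := \max_(ij <- S) ij.2.

Definition mmax (S : {fset nat * nat}) : nat :=
  \max_(ij <- S | ij.2 == ij.1.+1) ij.1.

(* [a, b] as a set of values of a permutation in 'S_n *)
Definition vint (n a b : nat) : {set 'I_n} := [set v : 'I_n | a <= v.+1 <= b].

(* {pi_1, ..., pi_m} *)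
Definition headvals (n m : nat) (pi : 'S_n) : {set 'I_n} :=
  [set pi i | i : 'I_n & i < m].

(* Since h m + k - 1 <= N for k <= m, truncating the intervals to values in
   'I_N loses nothing. *)
Definition acoef (h : nat -> nat) (S : {fset nat * nat}) (k : nat) : nat :=
  let m := mmax S in
  let N := m + h m - 1 in
  #|[set pi in Ih h S N |
      headvals m pi :&: vint N (h m) N == vint N (h m) (h m + k - 1)]|.

Local Open Scope ring_scope.

(* X (X - 1) ... (X - k + 1) / k!; n - h(m) + 1 can be negative when
   n >= j(S), so 'C(_, _) would not do. *)
Definition binp (k : nat) : {poly rat} :=
  (k`!%:R)^-1 *: \prod_(i < k) ('X - (i%:R)%:P).

(* Main.v *)
(** If [inv_h(pi) = S] and [m = m(S)], then [pi] is increasing from position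
    [m + 1] on, so [pi] is determined by [pi_1, ..., pi_m].  Fix a threshold
    [M > m] and let [A] be the set of values at least [M] among
    [pi_1, ..., pi_m].  Relabelling [A] increasingly by another set of the same
    size and sorting the tail again preserves [inv_h(pi) = S], provided
    [h a <= M] whenever [(a, M)] is in [S].  Hence the number of such [pi]
    depends only on [#|A|], and summing over [A] gives
    [I_h(S; n) = sum_k a_k^M binom(n - M + 1, k)] for [n >= M - 1].
    The threshold [M = h(m)] gives the announced coefficients but only covers
    [n >= h(m) - 1]; the threshold [M = j(S) + 1] covers all [n >= j(S)].  The two
    polynomials agree for large [n], so they are equal. *)

Require Import Defs.
From mathcomp Require Import zify.

Set Implicit Arguments.
Unset Strict Implicit.
Unset Printing Implicit Defensive.

(** * Permutations as functions on the naturals *)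

(* The identity extension beyond [n] creates no inversions, so comparisons of
   [pval] need no bounds on the positions. *)
Definition pval (n : nat) (pi : 'S_n) (l : nat) : nat :=
  if insub l is Some i then nat_of_ord (pi i) else l.

Lemma pval_ord n (pi : 'S_n) (i : 'I_n) : pval pi i = pi i.
Proof. by rewrite /pval valK. Qed.

Lemma pval_ge n (pi : 'S_n) l : n <= l -> pval pi l = l.
Proof. by move=> le_nl; rewrite /pval insubN // -leqNgt. Qed.

Lemma pval_lt n (pi : 'S_n) l : (pval pi l < n) = (l < n).
Proof.
have [lt_ln|le_nl] := ltnP l n; last by rewrite pval_ge // ltnNge le_nl.
by rewrite -[l]/(nat_of_ord (Ordinal lt_ln)) pval_ord ltn_ord.
Qed.

Lemma pval_inj n (pi : 'S_n) : injective (pval pi).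
Proof.
move=> a b eq_ab; have eq_n : (a < n) = (b < n) by rewrite -(pval_lt pi a) eq_ab pval_lt.
have [lt_an|le_na] := ltnP a n; last first.
  by move: eq_ab; rewrite !pval_ge // leqNgt -eq_n -leqNgt.
have lt_bn : b < n by rewrite -eq_n.
move: eq_ab; rewrite -[a]/(nat_of_ord (Ordinal lt_an)).
by rewrite -[b]/(nat_of_ord (Ordinal lt_bn)) !pval_ord => /val_inj/perm_inj ->.
Qed.

Lemma eq_pval n (pi rho : 'S_n) :
  (forall l, l < n -> pval pi l = pval rho l) -> pi = rho.
Proof.
by move=> eq_pr; apply/permP=> i; apply: val_inj; rewrite /= -!pval_ord eq_pr.
Qed.

Lemma sum_ltn_nat m n x : m <= x <= n -> \sum_(m <= l < n) (l < x) = x - m.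
Proof.
case/andP=> le_mx le_xn; rewrite (big_cat_nat le_mx le_xn) /=.
rewrite (eq_big_nat _ _ (F2 := fun=> 1)) => [|l /andP[_ ->] //].
rewrite sum_nat_const_nat muln1 big_nat big1 ?addn0 // => l /andP[le_xl _].
by rewrite ltnNge le_xl.
Qed.

Lemma sum_pval_lt n (pi : 'S_n) x : x <= n -> \sum_(0 <= l < n) (pval pi l < x) = x.
Proof.
move=> le_xn; rewrite -[RHS]subn0 -(@sum_ltn_nat 0 n) // !big_mkord.
rewrite [RHS](reindex_inj (@perm_inj _ pi)) /=.
by apply: eq_bigr => i _; rewrite pval_ord.
Qed.

Lemma in_invh h n (pi : 'S_n) a b :
  ((a.+1, b.+1) \in invh h pi) = Ph h (a.+1, b.+1) && (pval pi b < pval pi a).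
Proof.
apply/imfsetP/andP => [[[i j] /= /andP[ij_Ph lt_ji] [-> ->]]|[ab_Ph lt_ba]].
  by rewrite !pval_ord.
have lt_ab : a < b by case/and3P: ab_Ph.
have lt_bn : b < n.
  rewrite ltnNge; apply/negP=> le_nb; move: lt_ba; rewrite (pval_ge _ le_nb).
  have [lt_an|le_na] := ltnP a n; last by rewrite pval_ge // ltnNge ltnW.
  by move: lt_an; rewrite -(pval_lt pi); lia.
exists (Ordinal (ltn_trans lt_ab lt_bn), Ordinal lt_bn) => //=.
by apply/andP; split; rewrite -?pval_ord.
Qed.

Lemma invh_Ph h n (pi : 'S_n) ab : ab \in invh h pi -> Ph h ab.
Proof. by case/imfsetP=> -[i j] /= /andP[? _] ->. Qed.

Lemma eq_invh h n p (pi : 'S_n) (rho : 'S_p) :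
  (forall a b, Ph h (a.+1, b.+1) ->
     (pval pi b < pval pi a) = (pval rho b < pval rho a)) ->
  invh h pi = invh h rho.
Proof.
move=> eq_pr; apply/fsetP=> -[[|a] [|b]]; do ?by apply/idP/idP=> /invh_Ph.
by rewrite !in_invh; case: (boolP (Ph h _)) => //= /eq_pr ->.
Qed.

(** * Permutations increasing from position [m] on *)

Section Tail.

Variables (n m : nat) (pi : 'S_n).
Hypothesis le_mn : m <= n.
Hypothesis pi_tail : forall a b, m <= a -> a < b -> pval pi a < pval pi b.

(** Since the tail increases, a tail value below [x] must sit before position [j]. *)
Lemma sum_tail_le x j :
  m <= j -> x <= pval pi j -> \sum_(m <= l < n) (pval pi l < x) <= j - m.
Proof.
move=> le_mj le_xj.
(* Summing up to [n + j] covers the case [j > n]. *)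
have le_j : \sum_(m <= l < n) (pval pi l < x) <= \sum_(m <= l < n + j) (l < j).
  rewrite (big_cat_nat le_mn (leq_addr j n)) /=.
  apply: leq_trans (leq_addr _ _); rewrite big_nat_cond [leqRHS]big_nat_cond.
  apply: leq_sum => l /andP[/andP[le_ml _] _].
  case: (ltngtP l j) => [||->]; rewrite ?leq_b1 //.
    by move/(pi_tail le_mj); lia.
  by rewrite ltnNge le_xj.
by rewrite (leq_trans le_j) // sum_ltn_nat // le_mj leq_addl.
Qed.

Lemma sum_tail_gt x j :
  m <= j -> pval pi j < x -> j < n -> j - m < \sum_(m <= l < n) (pval pi l < x).
Proof.
move=> le_mj lt_jx lt_jn.
have <- : \sum_(m <= l < n) (l < j.+1) = (j - m).+1 by rewrite sum_ltn_nat; lia.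
rewrite big_nat_cond [leqRHS]big_nat_cond.
apply: leq_sum => l /andP[/andP[le_ml _] _].
rewrite ltnS; case: (ltngtP l j) => [lt_lj||->] //=; last by rewrite lt_jx.
by have := pi_tail le_ml lt_lj; lia.
Qed.

Lemma sum_pval_split x : x <= n ->
  \sum_(0 <= l < m) (pval pi l < x) + \sum_(m <= l < n) (pval pi l < x) = x.
Proof. by move=> le_xn; rewrite -big_cat_nat // sum_pval_lt. Qed.

(* [pi] is increasing from position [m] on, so [pi i] beats position [j] iff
   more than [j - m] tail values lie below [pi i]. *)
Lemma pval_lt_tail i j : i < m -> m <= j ->
  (pval pi j < pval pi i) =
  (j + \sum_(0 <= l < m) (pval pi l < pval pi i) < pval pi i + m).
Proof.
move=> lt_im le_mj; have lt_in : i < n by apply: leq_trans lt_im _.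
have lt_pi : pval pi i < n by rewrite pval_lt.
have sumE := sum_pval_split (ltnW lt_pi); apply/idP/idP => [lt_ji|].
  have lt_jn : j < n by rewrite -(pval_lt pi) (ltn_trans lt_ji).
  by have := sum_tail_gt le_mj lt_ji lt_jn; lia.
by apply: contraTltn => /(sum_tail_le le_mj); lia.
Qed.

(** A value is the number of values below it: [j - m] of them lie in the tail, the rest in the
    head. *)
Lemma pval_tail j : m <= j -> j < n ->
  pval pi j = j - m + \sum_(0 <= l < m) (pval pi l < pval pi j).
Proof.
move=> le_mj lt_jn; have lt_pj : pval pi j < n by rewrite pval_lt.
have := sum_pval_split (ltnW lt_pj).
rewrite [X in _ + X](_ : _ = j - m); first by lia.
rewrite -(@sum_ltn_nat m n) ?le_mj 1?ltnW //.
apply: eq_big_nat => l /andP[le_ml _]; congr nat_of_bool.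
case: (ltngtP l j) => [lt_lj|lt_jl|->]; rewrite ?ltnn //; first exact: pi_tail.
by apply/negbTE; rewrite -leqNgt ltnW // pi_tail.
Qed.

(* Otherwise the [x] values below [x] would all sit in positions below [j]
   other than [i]. *)
Lemma pval_lt_big x i j :
  x <= n -> i < m -> x <= pval pi i -> m <= j -> j <= x -> pval pi j < pval pi i.
Proof.
move=> le_xn lt_im le_xi le_mj le_jx; rewrite ltnNge; apply/negP=> le_ij.
have := sum_tail_le le_mj (leq_trans le_xi le_ij).
have := sum_pval_split le_xn.
(* Position [i] drops out of the head count, leaving at most [m - 1 + (j - m) < x] values below
   [x]. *)
have: \sum_(0 <= l < m) (pval pi l < x) <= m.-1; last by lia.
rewrite big_mkord (bigD1 (Ordinal lt_im)) //= ltnNge le_xi add0n.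
apply: leq_trans (_ : \sum_(l < m | l != Ordinal lt_im) 1 <= _).
  by apply: leq_sum => l _; apply: leq_b1.
by rewrite sum1_card cardC1 card_ord.
Qed.

End Tail.

(** * Reconstruction from the head *)

(** By [pval_tail] a tail value is fixed by the number of head values below it, and by
    [pval_lt_tail] the head alone decides which these are. *)
Lemma pval_head_inj n m (pi rho : 'S_n) :
  m <= n ->
  (forall a b, m <= a -> a < b -> pval pi a < pval pi b) ->
  (forall a b, m <= a -> a < b -> pval rho a < pval rho b) ->
  (forall l, l < m -> pval pi l = pval rho l) -> pi = rho.
Proof.
move=> le_mn pi_tail rho_tail eq_pr; apply: eq_pval => j lt_jn.
have [/eq_pr //|le_mj] := ltnP j m.
rewrite (pval_tail le_mn pi_tail) // (pval_tail le_mn rho_tail) //.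
congr (_ + _); apply: eq_big_nat => l /= lt_lm; congr nat_of_bool.
have ltP (t : 'S_n) : (pval t l < pval t j) = ~~ (pval t j < pval t l).
  by case: ltngtP => // /pval_inj; lia.
rewrite !ltP (pval_lt_tail le_mn pi_tail) // (pval_lt_tail le_mn rho_tail) //.
rewrite eq_pr //; congr (~~ (_ + _ < _)).
by apply: eq_big_nat => k /= /eq_pr ->.
Qed.

(** The prescribed values are listed first, then the remaining ones in increasing order. *)
Lemma perm_of_head n m (e : nat -> nat) :
  (forall i, i < m -> e i < n) ->
  {in [pred i | i < m] &, injective e} ->
  exists2 pi : 'S_n, forall i, i < m -> pval pi i = e i
                   & forall a b, m <= a -> a < b -> pval pi a < pval pi b.
Proof.
move=> lt_e inj_e; pose hd := [seq e i | i <- iota 0 m].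
pose tl := [seq v <- iota 0 n | v \notin hd]; pose s := hd ++ tl.
have uniq_hd : uniq hd.
  rewrite map_inj_in_uniq ?iota_uniq // => i j.
  by rewrite !mem_iota !add0n; apply: inj_e.
have perm_s : perm_eq s (iota 0 n).
  apply: uniq_perm; rewrite ?iota_uniq //.
    rewrite cat_uniq uniq_hd filter_uniq ?iota_uniq // andbT.
    by apply/hasPn=> v; rewrite mem_filter => /andP[].
  move=> v; rewrite mem_cat mem_filter.
  case: (boolP (v \in hd)) => //= /mapP[i]; rewrite !mem_iota !add0n => lt_im ->.
  by rewrite lt_e.
have size_hd : size hd = m by rewrite size_map size_iota.
have size_s : size s = n by rewrite (perm_size perm_s) size_iota.
have uniq_s : uniq s by rewrite (perm_uniq perm_s) iota_uniq.
have lt_s (i : 'I_n) : nth 0 s i < n.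
  have: nth 0 s i \in iota 0 n by rewrite -(perm_mem perm_s) mem_nth ?size_s.
  by rewrite mem_iota.
pose f i := Ordinal (lt_s i).
have inj_f : injective f.
  move=> i j /(congr1 (@nat_of_ord n)) /= /eqP.
  by rewrite nth_uniq ?size_s // => /eqP/val_inj.
have le_mn : m <= n by rewrite -size_s size_cat size_hd leq_addr.
have pvalE i : i < n -> pval (perm inj_f) i = nth 0 s i.
  by move=> lt_in; rewrite -[i in LHS]/(nat_of_ord (Ordinal lt_in)) pval_ord permE.
exists (perm inj_f) => [i lt_im|a b le_ma lt_ab].
  rewrite pvalE ?(leq_trans lt_im) // nth_cat size_hd lt_im.
  by rewrite (nth_map 0) ?size_iota // nth_iota.
have [lt_bn|le_nb] := ltnP b n; last first.
  rewrite (pval_ge _ le_nb); have [lt_an|le_na] := ltnP a n; last by rewrite pval_ge.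
  by rewrite (leq_trans _ le_nb) // pval_lt.
rewrite !pvalE ?(ltn_trans lt_ab) // !nth_cat size_hd !ltnNge le_ma.
rewrite (leq_trans le_ma (ltnW lt_ab)) /= -ltnNge.
have size_tl : size tl = n - m by rewrite -size_s size_cat size_hd addKn.
have sorted_tl : sorted ltn tl by rewrite sorted_filter ?iota_ltn_sorted //; apply: ltn_trans.
by apply: (sorted_ltn_nth ltn_trans) => //; rewrite ?inE ?size_tl; lia.
Qed.

(** * Relabelling of finite sets, maxima and intervals *)

(** The [k]-th smallest element of [A] is sent to the [k]-th smallest element of [B]. *)
Lemma ord_set_relabel n p (A : {set 'I_n}) (B : {set 'I_p}) :
  #|A| = #|B| ->
  exists phi : nat -> nat,
    [/\ forall a, a \in A -> exists2 b, b \in B & phi a = nat_of_ord b,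
        forall b, b \in B -> exists2 a, a \in A & phi a = nat_of_ord b
      & forall a a', a \in A -> a' \in A -> a < a' -> phi a < phi a'].
Proof.
pose vals q (C : {set 'I_q}) := [seq v <- iota 0 q | v \in map val (enum C)].
have sorted_vals q C : sorted ltn (@vals q C).
  by rewrite sorted_filter ?iota_ltn_sorted //; apply: ltn_trans.
have uniq_vals q C : uniq (@vals q C) by rewrite filter_uniq // iota_uniq.
have valsP q (C : {set 'I_q}) v :
    reflect (exists2 c, c \in C & v = nat_of_ord c) (v \in vals q C).
  rewrite mem_filter; apply: (iffP andP) => [[/mapP[c]]|[c Cc ->]].
    by rewrite mem_enum => Cc -> _; exists c.
  by rewrite map_f ?mem_enum // mem_iota add0n ltn_ord.
have mem_vals q (C : {set 'I_q}) (c : 'I_q) : c \in C -> nat_of_ord c \in vals q C.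
  by move=> Cc; apply/valsP; exists c.
have size_vals q (C : {set 'I_q}) : size (vals q C) = #|C|.
  rewrite cardE -(size_map val); apply/perm_size/uniq_perm => //.
    by rewrite map_inj_uniq ?enum_uniq //; apply: val_inj.
  move=> v; rewrite mem_filter; case: (boolP (v \in map val _)) => //= /mapP[c _ ->].
  by rewrite mem_iota add0n ltn_ord.
move=> eq_AB; pose phi x := nth 0 (vals p B) (index x (vals n A)).
have lt_index a : a \in A -> index (nat_of_ord a) (vals n A) < size (vals p B).
  by move=> Aa; rewrite size_vals -eq_AB -size_vals index_mem mem_vals.
exists phi; split=> [a Aa|b Bb|a a' Aa Aa' lt_aa'].
- by apply/valsP; rewrite mem_nth // lt_index.
- have lt_b : index (nat_of_ord b) (vals p B) < size (vals n A).
    by rewrite size_vals eq_AB -size_vals index_mem mem_vals.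
  have /valsP[a Aa eq_a] := mem_nth 0 lt_b.
  by exists a => //; rewrite /phi -eq_a index_uniq // nth_index // mem_vals.
- apply: (sorted_ltn_nth ltn_trans) => //; rewrite ?inE ?lt_index //.
  rewrite ltnNge; apply: contraL lt_aa' => le_a'a; rewrite -leqNgt.
  have := sorted_leq_nth leq_trans leqnn 0 (sub_sorted ltnW (sorted_vals n A)).
  by move/(_ _ _ _ _ le_a'a); rewrite !inE !index_mem !nth_index ?mem_vals //; apply.
Qed.

Lemma leq_mmax (S : {fset nat * nat}) a : (a, a.+1) \in S -> a <= mmax S.
Proof.
by move=> aS; apply: (leq_bigmax_seq (F := fun ij => ij.1) (a, a.+1)) => //=.
Qed.

Lemma leq_jmax (S : {fset nat * nat}) ab : ab \in S -> ab.2 <= jmax S.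
Proof. by move=> abS; apply: (leq_bigmax_seq (F := fun ij => ij.2) ab). Qed.

(** The bound [a <= b.+1] admits the empty interval, which occurs for [k = 0]. *)
Lemma card_vint n a b : 0 < a -> a <= b.+1 -> b <= n -> #|vint n a b| = b.+1 - a.
Proof.
move=> a_gt0 le_ab le_bn; rewrite -sum1dep_card big_mkcond /=.
rewrite -(big_mkord predT (fun l => if a <= l.+1 <= b then 1 else 0)).
have le_an : a.-1 <= n by lia.
rewrite (big_cat_nat (leq0n _) le_an) /= big_nat big1 => [|l]; last by case: ifP; lia.
have -> : b.+1 - a = b - a.-1 by lia.
rewrite -(@sum_ltn_nat a.-1 n); last by lia.
by apply: eq_big_nat => l; case: ifP; case: ltnP; lia.
Qed.

(** * Counting by the set of large head values *)

Section Counting.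

Variables (h : nat -> nat) (S : {fset nat * nat}).
Hypothesis h_gt : forall i, 0 < i -> i < h i.

Local Notation m := (mmax S).

(** A descent at a position beyond [m] would be an inversion [(l, l + 1)], allowed by [h l > l],
    against the maximality of [m]. *)
Lemma Ih_tail n (pi : 'S_n) : pi \in Ih h S n ->
  forall a b, m <= a -> a < b -> pval pi a < pval pi b.
Proof.
rewrite inE => /eqP inv_pi a b le_ma lt_ab.
apply: (homo_ltn_in (D := [pred l | m <= l]) (r := fun x y => x < y)) (lt_ab) => //.
- by move=> y x z; apply: ltn_trans.
- by move=> i j; rewrite !inE => le_mi _ k; rewrite inE; lia.
- move=> l; rewrite !inE => le_ml _; rewrite ltnNge; apply/negP=> le_l.
  have lS : (l.+1, l.+2) \in S.
    rewrite -inv_pi in_invh /Ph /= leqnn h_gt //=.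
    by rewrite ltn_neqAle le_l andbT; apply/eqP=> /pval_inj; lia.
  by have := leq_mmax lS; lia.
- by rewrite inE (leq_trans le_ma) // ltnW.
Qed.

(** The threshold [M] is a 1-based value, hence [M.-1] in comparisons with [pval]. *)
Definition Ih_big (M n : nat) (A : {set 'I_n}) : {set 'S_n} :=
  [set pi in Ih h S n | headvals m pi :&: vint n M n == A].

Variable M : nat.
Hypothesis lt_mM : m < M.
(* Holds for [M = h m] and for every [M > jmax S]. *)
Hypothesis h_le_M : forall a, (a, M) \in S -> h a <= M.

Lemma mem_vint n (v : 'I_n) : (v \in vint n M n) = (M.-1 <= v).
Proof. by rewrite inE ltn_ord andbT; lia. Qed.

Lemma Ih_big_head n (A : {set 'I_n}) pi i :
  m <= n -> pi \in Ih_big M A -> i < m -> M.-1 <= pval pi i ->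
  exists2 a, a \in A & pval pi i = nat_of_ord a.
Proof.
move=> le_mn; rewrite inE => /andP[_ /eqP <-] lt_im le_Mi.
have lt_in := leq_trans lt_im le_mn; exists (pi (Ordinal lt_in)).
  rewrite inE mem_vint -pval_ord /= le_Mi andbT.
  by apply/imsetP; exists (Ordinal lt_in); rewrite ?inE.
by rewrite -pval_ord.
Qed.

Lemma Ih_big_vals n (A : {set 'I_n}) pi a :
  pi \in Ih_big M A -> a \in A ->
  M.-1 <= a /\ exists2 i, i < m & pval pi i = nat_of_ord a.
Proof.
rewrite inE => /andP[_ /eqP <-]; rewrite inE mem_vint => /andP[/imsetP[i lt_im ->] le_Ma].
by split=> //; exists i; [move: lt_im; rewrite inE | rewrite pval_ord].
Qed.

(** Inversions are compared by cases: both positions in the tail, both in the head, or one in each;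
    the last case splits on whether the head value is below the threshold. *)
Lemma Ih_relabel n p (pi : 'S_n) (rho : 'S_p) (psi : nat -> nat) :
  M.-1 <= n -> M.-1 <= p -> pi \in Ih h S n ->
  (forall i, i < m -> pval rho i = psi (pval pi i)) ->
  (forall a b, m <= a -> a < b -> pval rho a < pval rho b) ->
  (forall i j, i < m -> j < m ->
     (psi (pval pi j) < psi (pval pi i)) = (pval pi j < pval pi i)) ->
  (forall i, i < m -> pval pi i < M.-1 -> psi (pval pi i) = pval pi i) ->
  (forall i, i < m -> M.-1 <= pval pi i -> M.-1 <= psi (pval pi i)) ->
  rho \in Ih h S p.
Proof.
move=> le_Mn le_Mp pi_Ih rho_head rho_tail mono_psi psi_small psi_big.
have pi_tail := Ih_tail pi_Ih; move: (pi_Ih); rewrite !inE => /eqP inv_pi.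
have le_mn : m <= n by lia.
have le_mp : m <= p by lia.
rewrite -[X in _ == X]inv_pi; apply/eqP/eq_invh => a b ab_Ph.
have lt_ab : a < b by case/and3P: ab_Ph.
have [lt_am|le_ma] := ltnP a m; last first.
  have := pi_tail _ _ le_ma lt_ab; have := rho_tail _ _ le_ma lt_ab.
  by move=> /ltnW; rewrite leqNgt => /negbTE-> /ltnW; rewrite leqNgt => /negbTE->.
have [lt_bm|le_mb] := ltnP b m; first by rewrite !rho_head // mono_psi.
(* A small value is fixed by [psi], and so is the number of head values below it, which decides the
   comparison. *)
have [lt_aM|le_Ma] := ltnP (pval pi a) M.-1.
  rewrite (pval_lt_tail le_mn pi_tail) // (pval_lt_tail le_mp rho_tail) //.
  rewrite !rho_head // (eq_big_nat _ _ (F2 := fun l => nat_of_bool (pval pi l < pval pi a))).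
    by rewrite psi_small.
  by move=> l /= lt_lm; rewrite rho_head // mono_psi.
(* If [h a.+1 > M], then [pval_lt_big] makes [(a.+1, M)] an inversion of [pi], contradicting
   [h_le_M]. *)
have le_bM : b <= M.-1.
  have le_hM : h a.+1 <= M.
    rewrite leqNgt; apply/negP=> lt_Mh; have: (a.+1, M) \in S; last by move/h_le_M; lia.
    have -> : M = M.-1.+1 by lia.
    rewrite -inv_pi in_invh (pval_lt_big le_mn pi_tail (x := M.-1)) //; last by lia.
    by rewrite /Ph /= andbT; lia.
  by case/and3P: ab_Ph => /=; lia.
rewrite (pval_lt_big le_mn pi_tail (x := M.-1)) //.
by rewrite (pval_lt_big le_mp rho_tail (x := M.-1)) // rho_head // psi_big.
Qed.

(** Relabelling [A] by [B] in the head and sorting the tail is an injection. *)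
Lemma leq_card_Ih_big n p (A : {set 'I_n}) (B : {set 'I_p}) :
  M.-1 <= n -> M.-1 <= p -> A \subset vint n M n -> B \subset vint p M p ->
  #|A| = #|B| -> #|Ih_big M A| <= #|Ih_big M B|.
Proof.
move=> le_Mn le_Mp sAM sBM /ord_set_relabel[phi [phiA phiB lt_phi]].
have le_mn : m <= n by lia.
have le_mp : m <= p by lia.
pose psi x := if x < M.-1 then x else phi x.
have MA a : a \in A -> M.-1 <= a by move/(subsetP sAM); rewrite mem_vint.
have MB b : b \in B -> M.-1 <= b by move/(subsetP sBM); rewrite mem_vint.
have psi_small x : x < M.-1 -> psi x = x by rewrite /psi => ->.
have psiA a : a \in A -> psi a = phi a by move/MA; rewrite /psi ltnNge => ->.
(* The possible head values of a member of [Ih_big M A]; [psi] is increasing on them. *)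
pose D x := x < M.-1 \/ exists2 a, a \in A & x = nat_of_ord a.
have lt_psi x y : D x -> D y -> x < y -> psi x < psi y.
  case=> [lt_xM|[a Aa ->]] [lt_yM|[b Bb ->]].
  - by rewrite !psi_small.
  - by rewrite psi_small // psiA //; have [c /MB le_Mc ->] := phiA _ Bb; lia.
  - by have := MA _ Aa; lia.
  - by rewrite !psiA //; apply: lt_phi.
have mono_psi x y : D x -> D y -> (psi x < psi y) = (x < y).
  move=> Dx Dy; case: (ltngtP x y) => [|/(lt_psi _ _ Dy Dx)|->]; rewrite ?ltnn //.
    exact: lt_psi.
  by move/ltnW; rewrite leqNgt => /negbTE.
have inj_psi x y : D x -> D y -> psi x = psi y -> x = y.
  move=> Dx Dy eq_xy; case: (ltngtP x y) => //; rewrite -mono_psi //; lia.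
have head_D pi i : pi \in Ih_big M A -> i < m -> D (pval pi i).
  move=> piA lt_im; have [|le_Mi] := ltnP (pval pi i) M.-1; first by left.
  by right; apply: Ih_big_head piA _ _.
(* Stated for every [pi], so that finite choice yields a total map [F]. *)
have ex_rho pi : exists rho : 'S_p, pi \in Ih_big M A ->
    rho \in Ih_big M B /\ forall i, i < m -> pval rho i = psi (pval pi i).
  have [piA|_] := boolP (pi \in Ih_big M A); last by exists 1%g.
  have [i lt_im|i j lt_im lt_jm|rho rho_head rho_tail] :=
    @perm_of_head p m (fun i => psi (pval pi i)).
  - case: (head_D pi i piA lt_im) => [lt_M|[a Aa ->]].
      by rewrite psi_small // (leq_trans lt_M).
    by rewrite psiA //; have [b _ ->] := phiA _ Aa.
  - by move/(inj_psi _ _ (head_D pi i piA lt_im) (head_D pi j piA lt_jm))/pval_inj.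
  exists rho => _; split=> //; have piI : pi \in Ih h S n by move: piA; rewrite inE => /andP[].
  rewrite inE (Ih_relabel (psi := psi) le_Mn le_Mp piI) //=.
  - apply/eqP/setP=> v; rewrite inE mem_vint; apply/andP/idP => [[/imsetP[i]]|Bv].
      rewrite inE => lt_im ->; rewrite -pval_ord rho_head // => le_M.
      case: (head_D pi i piA lt_im) => [lt_M|[a Aa eq_a]].
        by move: le_M; rewrite psi_small // leqNgt lt_M.
      have [b Bb eq_b] := phiA _ Aa; suff -> : rho i = b by [].
      by apply: val_inj; rewrite /= -pval_ord rho_head // eq_a psiA.
    split; last exact: MB.
    have [a Aa eq_a] := phiB _ Bv; have [_ [i lt_im eq_i]] := Ih_big_vals piA Aa.
    have lt_ip := leq_trans lt_im le_mp.
    apply/imsetP; exists (Ordinal lt_ip); rewrite ?inE //.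
    by apply: val_inj; rewrite /= -pval_ord rho_head // eq_i psiA.
  - by move=> i j lt_im lt_jm; apply: mono_psi; apply: head_D.
  - by move=> i lt_im; apply: psi_small.
  - move=> i lt_im le_M; case: (head_D pi i piA lt_im) => [|[a Aa ->]]; first by lia.
    by rewrite psiA //; have [b /MB ? ->] := phiA _ Aa.
have [F FP] := fin_all_exists ex_rho.
have Ih_of q (C : {set 'I_q}) pi : pi \in Ih_big M C -> pi \in Ih h S q.
  by rewrite inE => /andP[].
rewrite -(card_in_imset (f := F) (D := Ih_big M A)); last first.
  move=> pi1 pi2 pi1A pi2A eq_F.
  apply: (pval_head_inj le_mn (Ih_tail (Ih_of _ _ _ pi1A)) (Ih_tail (Ih_of _ _ _ pi2A))).
  move=> l lt_lm; apply: inj_psi; [exact: head_D|exact: head_D|].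
  have [_ <- //] := FP _ pi1A; have [_ <- //] := FP _ pi2A.
  by rewrite eq_F.
by apply/subset_leq_card/subsetP=> _ /imsetP[pi piA ->]; case: (FP _ piA).
Qed.

Lemma card_Ih_big n p (A : {set 'I_n}) (B : {set 'I_p}) :
  M.-1 <= n -> M.-1 <= p -> A \subset vint n M n -> B \subset vint p M p ->
  #|A| = #|B| -> #|Ih_big M A| = #|Ih_big M B|.
Proof. by move=> *; apply/eqP; rewrite eqn_leq !leq_card_Ih_big. Qed.

(** In size [m + M - 1] exactly [m] values are at least [M], enough for every [k <= m]. For
    [M = h m] this is [acoef h S k]. *)
Let a k := #|Ih_big M (vint (m + M - 1) M (M + k - 1))|.

Lemma card_Ih_bigE n (A : {set 'I_n}) : M.-1 <= n -> A \subset vint n M n ->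
  #|Ih_big M A| = \sum_(k < m.+1) (#|A| == k) * a k.
Proof.
move=> le_Mn sAM; have [le_Am|lt_mA] := leqP #|A| m.
  rewrite (bigD1 (Ordinal (le_Am : #|A| < m.+1))) //= eqxx mul1n big1 ?addn0.
    apply: card_Ih_big => //; first by lia.
      by apply/subsetP=> v; rewrite mem_vint inE; lia.
    by move: #|A| le_Am => x le_xm; rewrite card_vint; lia.
  by move=> k; rewrite -val_eqE /= eq_sym => /negbTE->.
(* More than [m] values cannot fit in [m] head positions, so both sides vanish. *)
rewrite big1 => [|k _]; last by rewrite gtn_eqF // (leq_trans (ltn_ord k)).
apply/eqP; rewrite cards_eq0; apply/eqP/setP=> pi; rewrite [RHS]inE.
apply: contraTF lt_mA; rewrite inE -leqNgt => /andP[_ /eqP <-].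
apply: leq_trans (subset_leq_card (subsetIl _ _)) _.
apply: leq_trans (leq_imset_card _ _) _.
rewrite (_ : #|_| = #|vint n 1 m|); first by rewrite card_vint; lia.
by apply: eq_card => i; rewrite !inE.
Qed.

(** The permutations are grouped by [A]; there are ['C(n.+1 - M, k)] sets [A] of size [k]. *)
Lemma card_IhE n : M.-1 <= n ->
  #|Ih h S n| = \sum_(k < m.+1) a k * 'C(n.+1 - M, k).
Proof.
move=> le_Mn; rewrite -sum1_card.
rewrite (partition_big (fun pi : 'S_n => headvals m pi :&: vint n M n)
           (fun A => A \subset vint n M n)) /=; last by move=> pi _; apply: subsetIr.
under eq_bigr => A sAM.
  rewrite (_ : \sum_(i in _ | _) _ = #|Ih_big M A|); last first.
    by rewrite -sum1_card; apply: eq_bigl => pi; rewrite !inE.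
  rewrite card_Ih_bigE //; over.
rewrite exchange_big /=; apply: eq_bigr => k _; rewrite -big_distrl mulnC /=.
congr (_ * _); rewrite -(@card_vint n M n) //; [|by lia|by lia].
rewrite -cards_draws -sum1dep_card big_mkcondr /=.
by apply: eq_bigr => A _; case: eqP.
Qed.

End Counting.

(** * Passage to polynomials *)

Local Open Scope ring_scope.

Lemma binp_nat k x : (binp k).[x%:R] = 'C(x, k)%:R.
Proof.
have prodE j : \prod_(i < j) ('X - (i%:R)%:P).[x%:R] = (x ^_ j)%:R :> rat.
  elim: j => [|j IHj]; first by rewrite big_ord0.
  rewrite big_ord_recr /= IHj ffactnSr natrM hornerXsubC.
  (* For [j > x] the truncated [x - j] is wrong, but the falling factorial is already 0. *)
  have [le_jx|lt_xj] := leqP j x; first by rewrite natrB.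
  by rewrite ffact_small // !mul0r.
rewrite /binp hornerZ horner_prod prodE -bin_ffact natrM mulrCA mulVf ?mulr1 //.
by rewrite pnatr_eq0 -lt0n fact_gt0.
Qed.

(** The difference has as many distinct roots as its size, hence is zero. *)
Lemma poly_nat_inj (p q : {poly rat}) K :
  (forall n : nat, (K <= n)%N -> p.[n%:R] = q.[n%:R]) -> p = q.
Proof.
move=> eq_pq; apply/eqP; rewrite -subr_eq0; apply/eqP.
pose rs := [seq (n%:R : rat) | n <- iota K (size (p - q))].
apply: (@roots_geq_poly_eq0 _ _ rs).
- apply/allP=> x /mapP[n]; rewrite mem_iota => /andP[le_Kn _] ->.
  by rewrite /root hornerD hornerN eq_pq // subrr.
- by rewrite map_inj_uniq ?iota_uniq // => i j /eqP; rewrite eqr_nat => /eqP.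
- by rewrite size_map size_iota.
Qed.

(** The threshold is kept general so that two expansions can be compared. *)
Definition binp_sum (m M : nat) (a : nat -> nat) : {poly rat} :=
  \sum_(k < m.+1) (a k)%:R *: (binp k \Po ('X - (M%:R)%:P + 1)).

Lemma horner_binp_sum m M a x :
  (binp_sum m M a).[x] = \sum_(k < m.+1) (a k)%:R * (binp k).[x - M%:R + 1].
Proof.
rewrite horner_sum; apply: eq_bigr => k _.
by rewrite hornerZ horner_comp !hornerE.
Qed.

Lemma horner_binp_sum_nat m M a n : (M <= n.+1)%N ->
  (binp_sum m M a).[n%:R] = (\sum_(k < m.+1) a k * 'C(n.+1 - M, k))%:R.
Proof.
move=> le_Mn; rewrite horner_binp_sum natr_sum; apply: eq_bigr => k _.
by rewrite natrM -binp_nat natrB // -natr1 addrAC.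
Qed.

Theorem theorem3p5 (h : nat -> nat) (S : {fset nat * nat})
    (h_incr : forall i j : nat, (0 < i)%N -> (i <= j)%N -> (h i <= h j)%N)
    (h_gt : forall i : nat, (0 < i)%N -> (i < h i)%N)
    (S_neq0 : S != fset0) (S_adm : admissible h S) :
  let m := mmax S in
  (forall n : nat, (jmax S <= n)%N ->
     #|Ih h S n|%:R =
     \sum_(k < m.+1) (acoef h S k)%:R * (binp k).[n%:R - (h m)%:R + 1])
  /\ (forall p : {poly rat},
        (forall n : nat, (jmax S <= n)%N -> p.[n%:R] = #|Ih h S n|%:R) ->
        p = \sum_(k < m.+1)
              (acoef h S k)%:R *: (binp k \Po ('X - ((h m)%:R)%:P + 1))).
Proof.
move=> m; case: S_adm => S_Ph [n0 [pi0 S_inv]].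
have pi0_tail : forall a b, (m <= a)%N -> (a < b)%N -> (pval pi0 a < pval pi0 b)%N.
  by apply: (@Ih_tail h); rewrite // inE S_inv.
(* A pair starting beyond [m] would be an inversion inside the increasing tail of [pi0]. *)
have S_le_m ab : ab \in S -> (0 < ab.1 <= m)%N.
  case: ab => [[|a] [|b]] abS; have /and3P[] := S_Ph _ abS => // _ lt_ab _.
  move: abS; rewrite S_inv in_invh => /andP[_]; apply: contraTT.
  by rewrite -!leqNgt => le_ma; apply/ltnW; apply: pi0_tail le_ma lt_ab.
have [ab0 ab0S] := fset0Pn _ S_neq0.
have m_gt0 : (0 < m)%N by have := S_le_m _ ab0S; lia.
have lt_mj : (m < jmax S)%N.
  have j_gt0 : (0 < jmax S)%N.
    apply: leq_trans (leq_jmax ab0S).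
    by have /and3P[_ lt_ab _] := S_Ph _ ab0S; apply: leq_trans lt_ab.
  rewrite -(prednK j_gt0) ltnS; apply/bigmax_leqP_seq => ab abS _.
  have /and3P[_ lt_ab _] := S_Ph _ abS.
  by rewrite -ltnS (prednK j_gt0) (leq_trans lt_ab) // leq_jmax.
pose Q M := binp_sum m M (fun k => #|Ih_big h S M (vint (m + M - 1) M (M + k - 1))|).
have QE M n : (m < M)%N -> (forall a, (a, M) \in S -> h a <= M)%N -> (M <= n.+1)%N ->
    (Q M).[n%:R] = #|Ih h S n|%:R.
  move=> lt_mM h_le le_Mn; rewrite (card_IhE h_gt lt_mM h_le); last by lia.
  by rewrite horner_binp_sum_nat.
(* For [M = h m], [h a <= h m] follows from [a <= m] and monotonicity. *)
have Q_hm n : (h m <= n.+1)%N -> (Q (h m)).[n%:R] = #|Ih h S n|%:R.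
  apply: QE; first exact: h_gt.
  by move=> a /S_le_m/andP[a_gt0 le_am]; apply: h_incr.
(* No pair of [S] ends at [(jmax S).+1], so the condition on [h] holds vacuously. *)
have Q_jmax n : (jmax S <= n)%N -> (Q (jmax S).+1).[n%:R] = #|Ih h S n|%:R.
  by move=> le_jn; apply: QE => //; [lia | move=> a /leq_jmax; rewrite ltnn].
have eq_Q : Q (h m) = Q (jmax S).+1.
  apply: (@poly_nat_inj _ _ (h m + jmax S)) => n le_n.
  by rewrite Q_hm ?Q_jmax //; lia.
split=> [n le_jn|p pE].
  by rewrite -Q_jmax // -eq_Q horner_binp_sum.
(* The coefficients of [Q (h m)] unfold to [acoef h S k]. *)
rewrite -[RHS]/(Q (h m)) eq_Q; apply: (@poly_nat_inj _ _ (jmax S)) => n le_jn.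
by rewrite pE // Q_jmax.
Qed.
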